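(* Consider $N$ robotic agents rigidly grasping an object in $\mathcal{W}$, subject to the coupled dynamics described in the context, with workspace partition $\Pi$, $\mathcal{A}(\overline q(0))\in\pi_{r_1}$ for some $\pi_{r_1}\in\Pi$, an MITL formula $\phi$ over $\mathcal{AP}$ and labeling function $\mathcal{L}:\Pi\to2^{\mathcal{AP}}$. Let $r_\phi=(\pi_{r_1},t_1)(\pi_{r_2},t_2)\dots$ be a timed run of the weighted transition system $\mathcal{T}$ that satisfies $\phi$. Then the execution of $r_\phi$, i.e. the application of the switching control protocol $\overline u=U^{r_{j+1}}_{r_j}(t)$ for $t\in[t_j,t_j+\delta t_{r_j,r_{j+1}})$, $j\in\mathbb{N}$, produces a trajectory $\overline q(t)$, $t\ge0$, of the coupled object-agents system with a timed sequence $\beta_\phi=(\overline q_1(t),t_1)(\overline q_2(t),t_2)\dots$, $\mathcal{A}(\overline q_j(t_j))\in\pi_{r_j}$ for all $j\in\mathbb{N}$, whose timed behavior $\sigma_{\beta_\phi}$ satisfies $\sigma_{\beta_\phi}\models\phi$. Hence it provides a control strategy that achieves a timed sequence $\beta$ which yields the satisfaction of $\phi$.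
   Context: **Notation.** $\mathbb{N}$ is the set of positive integers. $\mathbb{T}^3$ is the 3-torus and $\mathbb{M}=\mathbb{R}^3\times\mathbb{T}^3$. $S(a)$ is the skew-symmetric matrix with $S(a)b=a\times b$. $d$ is the Euclidean distance in $\mathbb{R}^3$. $\mathcal{B}(c,r)$ is the ball in $\mathbb{R}^3$ with center $c$ and radius $r$. $(a)_k$, $k\in\{x,y,z\}$, are the coordinates of $a\in\mathbb{R}^3$. **Kinematics.** Agent $i$ has joint variables $q_i(t)\in\mathbb{R}^{\mathfrak{n}_i}$, $\mathfrak{n}_i\ge 6$; $\overline{q}=[q_1^T,\dots,q_N^T]^T\in\mathbb{R}^{\mathfrak{n}}$ with $\mathfrak{n}=\sum_i\mathfrak{n}_i$. The pose of the object's center of mass is $x_O(\overline q)=[p_O^T,\eta_O^T]^T\in\mathbb{M}$ and that of the $i$-th end-effector is $x_{E_i}(\overline q)=[p_{E_i}^T,\eta_{E_i}^T]^T\in\mathbb{M}$ (position and Euler angles in an inertial frame). Angular velocities are $\omega_O=J_O(\eta_O)\dot\eta_O$ and $\omega_{E_i}=J_{E_i}(\eta_{E_i})\dot\eta_{E_i}$, with $J_O,J_{E_i}$ smooth $3\times 3$ matrix functions. Grasps are rigid: $p_{E_i}=p_O+R_O(\eta_O)p^{O}_{E_i/O}$ with $R_O$ the object's rotation matrix and $p^O_{E_i/O}$ constant, $\eta_{E_i}=\eta_O+\alpha_i$ with $\alpha_i$ constant, and $\omega_{E_i}=\omega_O$. Hence $\dot x_{E_i}=J_{O_i}\dot x_O$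 with $$J_{O_i}=\begin{bmatrix} I_{3} & S(p_O-p_{E_i})J_O(\eta_O)\\ 0 & J_{E_i}^{-1}(\eta_{E_i})J_O(\eta_O)\end{bmatrix}.$$ The agents and the object are assumed away from kinematic and representation singularities, so $J_O^{-1},J_{E_i}^{-1}$ are well defined and smooth and $J_{O_i}$ is invertible. **Dynamics.** Object: $M_O(x_O)\ddot x_O+C_O(x_O,\dot x_O)\dot x_O+g_O(x_O)+w_O(t)=\lambda_O$. Agents: $M_i(x_{E_i})\ddot x_{E_i}+C_i(x_{E_i},\dot x_{E_i})\dot x_{E_i}+g_i(x_{E_i})+f_i(x_{E_i},\dot x_{E_i})+w_i(t)+\lambda_i=u_i$, with control input $u_i\in\mathbb{R}^6$. $M_O,M_i$ are positive definite, all vector fields are continuous and unknown, and $w_O,w_i$ are bounded. The forces satisfy $\lambda_O=G^T\overline\lambda$, where $\overline\lambda=[\lambda_1^T,\dots,\lambda_N^T]^T$ and $G(\overline x)=[J_{O_1}^T,\dots,J_{O_N}^T]^T$, $\overline x=[x_O^T,x_{E_1}^T,\dots,x_{E_N}^T]^T$. With $\overline u=[u_1^T,\dots,u_N^T]^T$, $\overline M,\overline C$ (block diagonal) and $\overline g,\overline f,\overline w$ (stacked) collecting the agents' terms, the coupled dynamics are $$\widetilde{M}(\overline{x})\ddot{x}_O+\widetilde{C}(\overline{x},\dot{\overline{x}})\dot{x}_O+\widetilde{h}(\overline{x},\dot{\overline{x}})+\widetilde{w}(\overline{x},t)=G^{T}(\overline{x})\overline{u},$$ $\widetilde M=M_O+G^T\overline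 MG$, $\widetilde C=C_O+G^T\overline M\dot G+G^T\overline CG$, $\widetilde h=g_O+G^T\overline g+G^T\overline f$, $\widetilde w=w_O+G^T\overline w$. **Workspace partition.** $\mathcal{S}_{\overline q}\subset\mathcal{W}$ is the set of points physically belonging to the agents or the object at configuration $\overline q$. The constant $\hat L$ satisfies $\hat L\ge\sup_{\overline q\in\mathbb{R}^{\mathfrak n},\,p_s\in\mathcal{S}_{\overline q}}d(p_s,p_O(\overline q))$, and $l_0>0$ is an arbitrary constant. The bounded workspace $\mathcal{W}\subset\mathbb{R}^3$ is partitioned into $R$ cubes $\Pi=\{\pi_1,\dots,\pi_R\}$ with centers $p^c_{\pi_j}$: $$\pi_j=\{p\in\mathcal{W}: (p)_k\in[(p^c_{\pi_j})_k-\hat L-l_0,\ (p^c_{\pi_j})_k+\hat L+l_0),\ \forall k\in\{x,y,z\}\},$$ pairwise disjoint, with $d(p^c_{\pi_{j+1}},p^c_{\pi_j})=2\hat L+2l_0$ for $j\in\{1,\dots,R-1\}$ and $(p^c_{\pi_j})_z=\hat L+l_0$ for all $j$. Adjacent regions: $\mathcal{D}(\pi_j)=\{\pi_{j'}\in\Pi: d(p^c_{\pi_j},p^c_{\pi_{j'}})=2\hat L+2l_0\}$. **System in a region.** $\mathcal{A}(\overline q)\in\pi_j$ means: (i) $p_s\in\pi_j$ for all $p_s\in\mathcal{S}_{\overline q}$, and (ii) $d(p_O(\overline q),p^c_{\pi_j})<l_0$. **Transition.** If $\mathcal{A}(\overline q(t_0))\in\pi_j$, there is a transition $\pi_j\to\pi_{j'}$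 with time duration $\delta t_{j,j'}\ge0$ iff there is a bounded control trajectory $\overline u$ in the coupled dynamics such that $\mathcal{A}(\overline q(t_0+\delta t_{j,j'}))\in\pi_{j'}$ and $p_s\in\pi_j\cup\pi_{j'}$ for all $p_s\in\mathcal{S}_{\overline q(t)}$, $t\in[t_0,t_0+\delta t_{j,j'}]$. **Control protocol $U_j^{j'}$ for $\pi_{j'}\in\mathcal{D}(\pi_j)$, started at time $t_0$ with $\mathcal{A}(\overline q(t_0))\in\pi_j$, for a predefined duration $\delta t_{j,j'}$.** Desired trajectory: $p_d:[t_0,\infty)\to\mathbb{R}^3$ is smooth, moves along the line segment from $p^c_{\pi_j}$ to $p^c_{\pi_{j'}}$, with $p_d(t_0)=p^c_{\pi_j}$, $p_d(t)=p^c_{\pi_{j'}}$ for $t\ge t_0+\delta t_{j,j'}$, and the open ball $\mathcal{B}(p_d(t),\hat L+l_0)\subset\pi_j\cup\pi_{j'}$ for $t\ge t_0$; $\eta_d:[t_0,\infty)\to\mathbb{T}^3$ is a smooth desired orientation; $x_d=[p_d^T,\eta_d^T]^T$ has bounded derivative. For $k\in\{1,\dots,6\}$: - $e_s=x_O-x_d$; $\rho_{s_k}(t)=(\rho^0_{s_k}-\rho^\infty_{s_k})e^{-l_{s_k}(t-t_0)}+\rho^\infty_{s_k}$ with $\rho^0_{s_k}=l_0$ for $k\in\{1,2,3\}$, $\rho^0_{s_k}>|e_{s_k}(t_0)|$ for $k\in\{4,5,6\}$, and $\rho^0_{s_k}>\rho^\infty_{s_k}>0$, $l_{s_k}>0$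 for all $k$. - $\xi_{s_k}=\rho_{s_k}^{-1}e_{s_k}$, $\dot x^*_{d_k}=-g_{s_k}\ln\frac{1+\xi_{s_k}}{1-\xi_{s_k}}$, $g_{s_k}>0$, $\dot x_d^*=[\dot x^*_{d_1},\dots,\dot x^*_{d_6}]^T$. - $e_v=\dot x_O-\dot x^*_d$; $\rho_{v_k}(t)=(\rho^0_{v_k}-\rho^\infty_{v_k})e^{-l_{v_k}(t-t_0)}+\rho^\infty_{v_k}$ with $\rho^0_{v_k}>|e_{v_k}(t_0)|$, $\rho^0_{v_k}>\rho^\infty_{v_k}>0$, $l_{v_k}>0$. - $P_v=\mathrm{diag}(\rho_{v_1},\dots,\rho_{v_6})$, $\xi_v=P_v^{-1}e_v$, $R_v=\mathrm{diag}\big(\tfrac{2}{1-\xi_{v_1}^2},\dots,\tfrac{2}{1-\xi_{v_6}^2}\big)$, $\varepsilon_v=\big[\ln\tfrac{1+\xi_{v_1}}{1-\xi_{v_1}},\dots,\ln\tfrac{1+\xi_{v_6}}{1-\xi_{v_6}}\big]^T$. - $U_j^{j'}(t)=\overline u=[u_1^T,\dots,u_N^T]^T$ with $u_i=-c_ig_vJ_{O_i}^{-T}P_v^{-1}R_v\varepsilon_v$, $g_v>0$, $0\le c_i\le1$, $\sum_{i=1}^Nc_i=1$. It is taken as an established fact that this protocol achieves the transition $\pi_j\to\pi_{j'}$ with time duration $\delta t_{j,j'}$ for every $\pi_j\in\Pi$, $\pi_{j'}\in\mathcal{D}(\pi_j)$; the abstraction $\mathcal{T}$ is based on this fact. **MITL.**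 Formulas over atomic propositions $\mathcal{AP}$: $\phi:=p\mid\neg\phi\mid\phi_1\land\phi_2\mid\bigcirc_I\phi\mid\lozenge_I\phi\mid\square_I\phi\mid\phi_1\mathcal{U}_I\phi_2$, with $p\in\mathcal{AP}$ and $I$ one of $[i_1,i_2],[i_1,i_2),(i_1,i_2],(i_1,i_2),[i_1,\infty),(i_1,\infty)$, $i_1,i_2\in\mathbb{R}_{\ge0}$, $i_2>i_1$. For an infinite sequence $r=(r_1,t_1)(r_2,t_2)\dots$ with $r_j\in2^{\mathcal{AP}}$, $t_j\in\mathbb{R}_{\ge0}$, $t_{j+1}>t_j$: $(r,j)\models p$ iff $p\in r_j$; $(r,j)\models\neg\phi$ iff $(r,j)\not\models\phi$; $(r,j)\models\phi_1\land\phi_2$ iff $(r,j)\models\phi_1$ and $(r,j)\models\phi_2$; $(r,j)\models\bigcirc_I\phi$ iff $(r,j+1)\models\phi$ and $t_{j+1}-t_j\in I$; $(r,j)\models\phi_1\mathcal{U}_I\phi_2$ iff there is $k\ge j$ with $(r,k)\models\phi_2$, $t_k-t_j\in I$ and $(r,m)\models\phi_1$ for all $j\le m\le k$. Also $\lozenge_I\phi=\mathrm{True}\,\mathcal{U}_I\phi$, $\square_I\phi=\neg\lozenge_I\neg\phi$, and $r\models\phi$ iff $(r,1)\models\phi$. **Specification.** $\mathcal{L}:\Pi\to2^{\mathcal{AP}}$ assigns to each region the atomic propositions true in it. For a trajectory $\overline q(t)$, a timed sequence is an infinite sequence $\beta=(\overline q_1(t),t_1)(\overline q_2(t),t_2)\dots$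 with $t_m\in\mathbb{R}_{\ge0}$, $t_{m+1}>t_m$ and $\mathcal{A}(\overline q_m(t_m))\in\pi_{j_m}$, $j_m\in\{1,\dots,R\}$, for all $m\in\mathbb{N}$ (here $\overline q_m(t_m)$ is the value at time $t_m$ of the trajectory). Its timed behavior is $\sigma_\beta=(\sigma_1,t_1)(\sigma_2,t_2)\dots$ with $\sigma_m=\mathcal{L}(\pi_{j_m})$. $\beta$ satisfies $\phi$ iff $\sigma_\beta\models\phi$. **Weighted transition system.** $\mathcal{T}=\{\Pi,\Pi_0,\rightarrow,\mathcal{AP},\mathcal{L},\gamma\}$ with states $\Pi$, initial states $\Pi_0\subset\Pi$, transition relation $\rightarrow\subseteq\Pi\times\Pi$ consisting of the pairs $(\pi_j,\pi_{j'})$ with $\pi_{j'}\in\mathcal{D}(\pi_j)$ for which, whenever $\mathcal{A}(\overline q(t_0))\in\pi_j$, there is a bounded control trajectory $\overline u$ in the coupled dynamics such that $\mathcal{A}(\overline q(t_0+\delta t_{j,j'}))\in\pi_{j'}$ and $p_s\in\pi_j\cup\pi_{j'}$ for all $p_s\in\mathcal{S}_{\overline q(t)}$, $t\in[t_0,t_0+\delta t_{j,j'}]$, and $\gamma(\pi_j\to\pi_{j'})=\delta t_{j,j'}$. A timed run of $\mathcal{T}$ is an infinite sequence $r=(\pi_{r_1},t_1)(\pi_{r_2},t_2)\dots$ with $\pi_{r_1}\in\Pi_0$, $\mathcal{A}(\overline q(0))\in\pi_{r_1}$, $\pi_{r_j}\in\Pi$, $\pi_{r_j}\to\pi_{r_{j+1}}$,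 $t_1=0$, $t_{j+1}=t_j+\delta t_{r_j,r_{j+1}}$ for all $j\in\mathbb{N}$. It generates the timed word $w(r)=(\mathcal{L}(\pi_{r_1}),t_1)(\mathcal{L}(\pi_{r_2}),t_2)\dots$, and $r$ satisfies $\phi$ iff $w(r)\models\phi$. **Execution.** Executing $r_\phi$ means applying, on each interval $[t_j,t_j+\delta t_{r_j,r_{j+1}})$, the protocol $U_{r_j}^{r_{j+1}}$ started at time $t_0=t_j$. *)

(* Defs.v *)
(* MathComp / MathComp-Analysis; the reals are an arbitrary R : realType. *)
From HB Require Import structures.
From mathcomp Require Import all_boot all_order all_algebra.
From mathcomp Require Import all_classical all_reals all_analysis.
Set Implicit Arguments.
Unset Strict Implicit.
Unset Printing Implicit Defensive.
Import Order.TTheory GRing.Theory Num.Theory.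
Import numFieldNormedType.Exports.
Local Open Scope classical_set_scope.
Local Open Scope ring_scope.

(** * Preliminaries *)

Section Prelim.
Variable R : realType.

(* In finite dimension this is the usual class C^k. *)
Fixpoint Ck (V W : normedModType R) (k : nat) (f : V -> W) : Prop :=
  match k with
  | 0 => continuous f
  | k'.+1 => (forall x, differentiable f x) /\
             (forall v : V, Ck k' (fun x => 'D_v f x))
  end.

Definition smooth (V W : normedModType R) (f : V -> W) := forall k, Ck k f.

Definition edist (a b : 'cV[R]_3) : R :=
  Num.sqrt (\sum_(k < 3) (a k 0 - b k 0) ^+ 2).

Definition eball (c : 'cV[R]_3) (r : R) : set 'cV[R]_3 :=
  [set p | edist p c < r].

Definition crossp (a b : 'cV[R]_3) : 'cV[R]_3 :=
  let x := @Ordinal 3 0 isT in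
  let y := @Ordinal 3 1 isT in
  let z := @Ordinal 3 2 isT in
  \col_k (if k == x then a y 0 * b z 0 - a z 0 * b y 0
          else if k == y then a z 0 * b x 0 - a x 0 * b z 0
          else a x 0 * b y 0 - a y 0 * b x 0).

Definition Smx (a : 'cV[R]_3) : 'M[R]_3 :=
  \matrix_(i, j) crossp a (delta_mx j 0) i 0.

(* Symmetry is not required. *)
Definition posdefmx m (A : 'M[R]_m) :=
  forall v : 'cV[R]_m, v != 0 -> 0 < (v^T *m A *m v) 0 0.

(* An element of R^3 x T^3 is represented by a vector of R^6 = R^(3 + 3): the
   position followed by real representatives of the three angles, which are
   meant modulo 2 pi. *)
Definition pos (x : 'cV[R]_6) : 'cV[R]_3 := usubmx (x : 'cV[R]_(3 + 3)).
Definition ang (x : 'cV[R]_6) : 'cV[R]_3 := dsubmx (x : 'cV[R]_(3 + 3)).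

Definition angle_eq (a b : 'cV[R]_3) :=
  forall k, exists z : int, a k 0 - b k 0 = 2 * pi * z%:~R.

Definition pose_eq (x y : 'cV[R]_6) :=
  pos x = pos y /\ angle_eq (ang x) (ang y).

Definition on_torus (T : Type) (f : 'cV[R]_3 -> T) :=
  forall a b, angle_eq a b -> f a = f b.

Definition on_poses (T : Type) (f : 'cV[R]_6 -> T) :=
  forall x y, pose_eq x y -> f x = f y.

End Prelim.

(** * MITL *)

Section MITL.
Variables (R : realType) (AP : Type).

(* [i1,i2], [i1,i2), (i1,i2], (i1,i2), [i1,oo), (i1,oo) with 0 <= i1 < i2. *)
Definition is_time_itv (I : interval R) : bool :=
  match I with
  | Interval (BSide _ i1) (BSide _ i2) => (0 <= i1) && (i1 < i2)
  | Interval (BSide _ i1) (BInfty false) => 0 <= i1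
  | _ => false
  end.

Record time_itv := TimeItv { itv_of : interval R; _ : is_time_itv itv_of }.

Inductive mitl : Type :=
| Atom of AP
| Neg of mitl
| And of mitl & mitl
| Next of time_itv & mitl
| Eventually of time_itv & mitl
| Always of time_itv & mitl
| Until of time_itv & mitl & mitl.

(* Positions are counted from 0. *)
Definition timed_word := nat -> set AP * R.

(* The first argument is required up to and including the witness k. *)
Definition until_at (w : timed_word) (I : time_itv) (P Q : nat -> Prop)
    (j : nat) : Prop :=
  exists k, [/\ (j <= k)%N, Q k, (w k).2 - (w j).2 \in itv_of I &
    forall m, (j <= m <= k)%N -> P m].

Fixpoint models_at (w : timed_word) (phi : mitl) (j : nat) : Prop :=
  match phi with
  | Atom p => (w j).1 p
  | Neg f => ~ models_at w f j
  | And f g => models_at w f j /\ models_at w g j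
  | Next J f => models_at w f j.+1 /\ (w j.+1).2 - (w j).2 \in itv_of J
  | Eventually J f => until_at w J (fun=> True) (models_at w f) j
  | Always J f => ~ until_at w J (fun=> True) (fun k => ~ models_at w f k) j
  | Until J f g => until_at w J (models_at w f) (models_at w g) j
  end.

Definition models (w : timed_word) (phi : mitl) := models_at w phi 0.

End MITL.

(** * Object and agents *)

Section System.
Variables (R : realType) (N : nat) (n : 'I_N -> nat).

Local Notation conf := 'cV[R]_(\sum_(i < N) n i).

(* Configurations form a simply connected space, so the continuous pose maps
   into R^3 x T^3 are given through lifts to R^3 x R^3. *)
Record system := System {
  xO : conf -> 'cV[R]_6;
  xE : 'I_N -> conf -> 'cV[R]_6;
  JO : 'cV[R]_3 -> 'M[R]_3;
  JE : 'I_N -> 'cV[R]_3 -> 'M[R]_3;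
  RO : 'cV[R]_3 -> 'M[R]_3;
  pEO : 'I_N -> 'cV[R]_3;       (* end-effector position in the object frame *)
  alpha : 'I_N -> 'cV[R]_3;
  MO : 'cV[R]_6 -> 'M[R]_6;
  CO : 'cV[R]_6 -> 'cV[R]_6 -> 'M[R]_6;
  gO : 'cV[R]_6 -> 'cV[R]_6;
  wO : R -> 'cV[R]_6;
  MA : 'I_N -> 'cV[R]_6 -> 'M[R]_6;
  CA : 'I_N -> 'cV[R]_6 -> 'cV[R]_6 -> 'M[R]_6;
  gA : 'I_N -> 'cV[R]_6 -> 'cV[R]_6;
  fA : 'I_N -> 'cV[R]_6 -> 'cV[R]_6 -> 'cV[R]_6;
  wA : 'I_N -> R -> 'cV[R]_6 }.

Variable S : system.

Definition bounded_disturbance (w : R -> 'cV[R]_6) :=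
  {within `[0, +oo[, continuous w} /\
  exists B, forall t, 0 <= t -> `|w t| <= B.

Record kinematics_ok : Prop := {
  _ : Ck 1 (xO S);
  _ : forall i, Ck 1 (xE S i);
  _ : smooth (JO S) /\ on_torus (JO S);
  _ : forall i, smooth (JE S i) /\ on_torus (JE S i);
  _ : smooth (RO S) /\ on_torus (RO S);
  _ : forall eta, (RO S eta)^T *m RO S eta = 1%:M /\ \det (RO S eta) = 1;
  (* omega_O = J_O(eta_O) eta_O' is the angular velocity of R_O(eta_O). *)
  _ : forall eta v,
        'D_v (RO S) eta = Smx (JO S eta *m v) *m RO S eta }.

Record dynamics_ok : Prop := {
  _ : continuous (MO S) /\ on_poses (MO S);
  _ : forall x, posdefmx (MO S x);
  _ : continuous (fun z : 'cV[R]_6 * 'cV[R]_6 => CO S z.1 z.2) /\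
      on_poses (CO S);
  _ : continuous (gO S) /\ on_poses (gO S);
  _ : bounded_disturbance (wO S);
  _ : forall i, continuous (MA S i) /\ on_poses (MA S i);
  _ : forall i x, posdefmx (MA S i x);
  _ : forall i, continuous (fun z : 'cV[R]_6 * 'cV[R]_6 => CA S i z.1 z.2) /\
      on_poses (CA S i);
  _ : forall i, continuous (gA S i) /\ on_poses (gA S i);
  _ : forall i, continuous (fun z : 'cV[R]_6 * 'cV[R]_6 => fA S i z.1 z.2) /\
      on_poses (fA S i);
  _ : forall i, bounded_disturbance (wA S i) }.

Definition vO (q dq : conf) : 'cV[R]_6 := 'D_dq (xO S) q.
Definition vE i (q dq : conf) : 'cV[R]_6 := 'D_dq (xE S i) q.

Definition omegaO q dq := JO S (ang (xO S q)) *m ang (vO q dq).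
Definition omegaE i q dq := JE S i (ang (xE S i q)) *m ang (vE i q dq).

Definition rigid_grasp (q dq : conf) :=
  forall i,
  [/\ pos (xE S i q) = pos (xO S q) + RO S (ang (xO S q)) *m pEO S i,
      angle_eq (ang (xE S i q)) (ang (xO S q) + alpha S i),
      pos (vE i q dq) = pos (vO q dq) + crossp (omegaO q dq)
                                          (pos (xE S i q) - pos (xO S q)),
      ang (vE i q dq) = ang (vO q dq) &
      omegaE i q dq = omegaO q dq].

(* No representation singularity of the Euler angles, no kinematic singularity
   of the agents. *)
Definition nonsingular (q : conf) :=
  JO S (ang (xO S q)) \in unitmx /\
  forall i, JE S i (ang (xE S i q)) \in unitmx /\
    forall w : 'cV[R]_6, exists dq, vE i q dq = w.

Definition admissible (q dq : conf) := rigid_grasp q dq /\ nonsingular q.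

Definition JOi i (q : conf) : 'M[R]_6 :=
  let etaO := ang (xO S q) in let etaE := ang (xE S i q) in
  block_mx 1%:M (Smx (pos (xO S q) - pos (xE S i q)) *m JO S etaO)
           0    (invmx (JE S i etaE) *m JO S etaO)
  : 'M[R]_(3 + 3).

Definition G (q : conf) : 'M[R]_(\sum_(i < N) 6, 6) := \mxcol_(i < N) JOi i q.

Definition dG (q dq : conf) : 'M[R]_(\sum_(i < N) 6, 6) := 'D_dq G q.

Definition Mbar (q : conf) : 'M[R]_(\sum_(i < N) 6) :=
  \mxdiag_(i < N) MA S i (xE S i q).
Definition Cbar (q dq : conf) : 'M[R]_(\sum_(i < N) 6) :=
  \mxdiag_(i < N) CA S i (xE S i q) (vE i q dq).
Definition gbar (q : conf) : 'cV[R]_(\sum_(i < N) 6) :=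
  \mxcol_(i < N) gA S i (xE S i q).
Definition fbar (q dq : conf) : 'cV[R]_(\sum_(i < N) 6) :=
  \mxcol_(i < N) fA S i (xE S i q) (vE i q dq).
Definition wbar (t : R) : 'cV[R]_(\sum_(i < N) 6) := \mxcol_(i < N) wA S i t.

Definition Mtilde (q : conf) : 'M[R]_6 :=
  MO S (xO S q) + (G q)^T *m Mbar q *m G q.
Definition Ctilde (q dq : conf) : 'M[R]_6 :=
  CO S (xO S q) (vO q dq) + (G q)^T *m Mbar q *m dG q dq
  + (G q)^T *m Cbar q dq *m G q.
Definition htilde (q dq : conf) : 'cV[R]_6 :=
  gO S (xO S q) + (G q)^T *m gbar q + (G q)^T *m fbar q dq.
Definition wtilde (q : conf) (t : R) : 'cV[R]_6 :=
  wO S t + (G q)^T *m wbar t.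

(* A trajectory q, with velocity dq, of the coupled system on [a, b] under the
   stacked input u.  The input may jump at a and at b, so the second-order
   equation is required in the open interval, q and dq being continuous up to
   the end points. *)
Definition coupled_solution (a b : R) (q dq : R -> conf)
    (u : R -> 'cV[R]_(\sum_(i < N) 6)) : Prop :=
  let v s := vO (q s) (dq s) in
  [/\ {within `[a, b], continuous q},
      {within `[a, b], continuous dq},
      forall t, a <= t <= b -> admissible (q t) (dq t),
      forall t, a < t < b -> derivable q t 1 /\ derive1 q t = dq t &
      forall t, a < t < b -> derivable v t 1 /\
        Mtilde (q t) *m derive1 v t + Ctilde (q t) (dq t) *m v t
        + htilde (q t) (dq t) + wtilde (q t) t = (G (q t))^T *m u t].

(** * Workspace *)

Variable nR : nat.

Record workspace := Workspace {
  W : set 'cV[R]_3;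
  center : 'I_nR -> 'cV[R]_3;
  Lhat : R;
  l0 : R;
  body : conf -> set 'cV[R]_3 }.

Variable E : workspace.

Definition region (j : 'I_nR) : set 'cV[R]_3 :=
  [set p | W E p /\ forall k : 'I_3,
    p k 0 \in `[center E j k 0 - Lhat E - l0 E,
                center E j k 0 + Lhat E + l0 E[].

Definition adjacent (j j' : 'I_nR) :=
  edist (center E j) (center E j') = 2 * Lhat E + 2 * l0 E.

Record workspace_ok : Prop := {
  _ : 0 < l0 E;
  _ : bounded_set (W E);
  _ : forall q, body E q !=set0 /\ body E q `<=` W E;
  _ : (ereal_sup [set (edist z.2 (pos (xO S z.1)))%:E |
                    z in [set z : conf * 'cV[R]_3 | body E z.1 z.2]]
       <= (Lhat E)%:E)%E;
  _ : W E = \bigcup_j region j;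
  _ : trivIset setT region;
  _ : forall j j' : 'I_nR, j' = j.+1 :> nat ->
        edist (center E j') (center E j) = 2 * Lhat E + 2 * l0 E;
  _ : forall j, center E j ord_max 0 = Lhat E + l0 E }.

Definition in_region (q : conf) (j : 'I_nR) :=
  body E q `<=` region j /\ edist (pos (xO S q)) (center E j) < l0 E.

(** * Transitions *)

Definition moves (j j' : 'I_nR) (a b : R) (q : R -> conf)
    (u : R -> 'cV[R]_(\sum_(i < N) 6)) : Prop :=
  [/\ exists B, forall t, a <= t < b -> `|u t| <= B,
      in_region (q b) j' &
      forall t, a <= t <= b -> body E (q t) `<=` region j `|` region j'].

Definition transition (dt : 'I_nR -> 'I_nR -> R) (j j' : 'I_nR) : Prop :=
  adjacent j j' /\
  forall t0 q0 dq0, 0 <= t0 -> admissible q0 dq0 -> in_region q0 j ->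
  exists q dq u,
    [/\ q t0 = q0, dq t0 = dq0,
        coupled_solution t0 (t0 + dt j j') q dq u &
        moves j j' t0 (t0 + dt j j') q u].

(** * Control protocol *)

(* Only the restrictions of pd and etad to [t0, oo) matter; a smooth function
   on the half-line is the restriction of one on R. *)
Record protocol := Protocol {
  pd : R -> 'cV[R]_3;
  etad : R -> 'cV[R]_3;
  rs0 : 'I_6 -> R; rsoo : 'I_6 -> R; ls : 'I_6 -> R; gs : 'I_6 -> R;
  rv0 : 'I_6 -> R; rvoo : 'I_6 -> R; lv : 'I_6 -> R;
  gv : R;
  cw : 'I_N -> R }.

Definition rho (r0 roo l t0 t : R) : R := (r0 - roo) * expR (- l * (t - t0)) + roo.

Definition logratio (xi : R) : R := ln ((1 + xi) / (1 - xi)).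

Section Protocol.
Variables (P : protocol) (t0 : R).

Definition xd (t : R) : 'cV[R]_6 := col_mx (pd P t) (etad P t) : 'cV[R]_(3 + 3).

Definition es (t : R) (q : conf) : 'cV[R]_6 := xO S q - xd t.

Definition xis (t : R) (q : conf) (k : 'I_6) : R :=
  (rho (rs0 P k) (rsoo P k) (ls P k) t0 t)^-1 * es t q k 0.

Definition vd (t : R) (q : conf) : 'cV[R]_6 :=
  \col_k (- gs P k * logratio (xis t q k)).

Definition ev (t : R) (q dq : conf) : 'cV[R]_6 := vO q dq - vd t q.

Definition Pv (t : R) : 'M[R]_6 :=
  diag_mx (\row_k rho (rv0 P k) (rvoo P k) (lv P k) t0 t).

Definition xiv (t : R) (q dq : conf) : 'cV[R]_6 := invmx (Pv t) *m ev t q dq.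

Definition Rv (t : R) (q dq : conf) : 'M[R]_6 :=
  diag_mx (\row_k (2 / (1 - xiv t q dq k 0 ^+ 2))).

Definition epsv (t : R) (q dq : conf) : 'cV[R]_6 :=
  \col_k logratio (xiv t q dq k 0).

Definition protocol_input (t : R) (q dq : conf) : 'cV[R]_(\sum_(i < N) 6) :=
  \mxcol_(i < N)
    (- (cw P i * gv P) *: (invmx (JOi i q)^T *m invmx (Pv t) *m Rv t q dq
                             *m epsv t q dq)).

(* Admissible design parameters for j -> j', started at t0 in the state
   (q0, dq0), with duration d. *)
Record protocol_ok (j j' : 'I_nR) (d : R) (q0 dq0 : conf) : Prop := {
  _ : smooth (pd P) /\ smooth (etad P);
  _ : forall t, t0 <= t -> exists2 s, 0 <= s <= 1 &
        pd P t = center E j + s *: (center E j' - center E j);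
  _ : pd P t0 = center E j;
  _ : forall t, t0 + d <= t -> pd P t = center E j';
  _ : forall t, t0 <= t ->
        eball (pd P t) (Lhat E + l0 E) `<=` region j `|` region j';
  _ : exists B, forall t, t0 <= t -> `|derive1 xd t| <= B;
  _ : forall k : 'I_6, (k < 3)%N -> rs0 P k = l0 E;
  _ : forall k : 'I_6, (3 <= k)%N -> `|es t0 q0 k 0| < rs0 P k;
  _ : forall k, [/\ 0 < rsoo P k, rsoo P k < rs0 P k, 0 < ls P k & 0 < gs P k];
  _ : forall k, `|ev t0 q0 dq0 k 0| < rv0 P k;
  _ : forall k, [/\ 0 < rvoo P k, rvoo P k < rv0 P k & 0 < lv P k];
  _ : 0 < gv P;
  _ : forall i, 0 <= cw P i <= 1;
  _ : \sum_i cw P i = 1 }.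

Definition closed_loop (d : R) (q dq : R -> conf)
    (u : R -> 'cV[R]_(\sum_(i < N) 6)) : Prop :=
  coupled_solution t0 (t0 + d) q dq u /\
  forall t, t0 <= t < t0 + d -> u t = protocol_input t (q t) (dq t).

End Protocol.

(* The family of protocols U_j^j': the design parameters used for j -> j' may
   depend on the starting time and on the state at that time. *)
Definition protocol_family := 'I_nR -> 'I_nR -> R -> conf -> conf -> protocol.

Definition family_ok (dt : 'I_nR -> 'I_nR -> R) (U : protocol_family) :=
  forall j j' t0 q0 dq0, adjacent j j' -> 0 <= t0 ->
    admissible q0 dq0 -> in_region q0 j ->
    protocol_ok (U j j' t0 q0 dq0) t0 j j' (dt j j') q0 dq0.

(* The protocols achieve every transition between adjacent regions: the closed
   loop has a solution from every starting state, and each of its solutions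
   makes the transition. *)
Definition achieves_transitions (dt : 'I_nR -> 'I_nR -> R)
    (U : protocol_family) :=
  forall j j' t0 q0 dq0, adjacent j j' -> 0 <= t0 ->
    admissible q0 dq0 -> in_region q0 j ->
    let P := U j j' t0 q0 dq0 in
    (exists q dq u,
       [/\ q t0 = q0, dq t0 = dq0 & closed_loop P t0 (dt j j') q dq u]) /\
    (forall q dq u, q t0 = q0 -> dq t0 = dq0 ->
       closed_loop P t0 (dt j j') q dq u ->
       moves j j' t0 (t0 + dt j j') q u).

(** * Weighted transition system, timed runs and sequences *)

Variable AP : Type.

(* The states are the (indices of the) regions. *)
Record wts := Wts {
  wts_init : set 'I_nR;
  wts_trans : 'I_nR -> 'I_nR -> Prop;
  wts_label : 'I_nR -> set AP;
  wts_weight : 'I_nR -> 'I_nR -> R }.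

Definition abstraction (Pi0 : set 'I_nR) (L : 'I_nR -> set AP)
    (dt : 'I_nR -> 'I_nR -> R) : wts :=
  Wts Pi0 (transition dt) L dt.

(* Positions are counted from 0; q0 is the configuration at time 0. *)
Definition timed_run (T : wts) (q0 : conf) (r : nat -> 'I_nR) (t : nat -> R) :=
  [/\ wts_init T (r 0%N),
      in_region q0 (r 0%N),
      forall m, wts_trans T (r m) (r m.+1),
      t 0%N = 0 &
      forall m, t m.+1 = t m + wts_weight T (r m) (r m.+1)].

Definition run_word (T : wts) (r : nat -> 'I_nR) (t : nat -> R) :
    timed_word R AP :=
  fun m => (wts_label T (r m), t m).

Definition timed_sequence (q : R -> conf) (beta : nat -> conf * R) :=
  forall m, [/\ 0 <= (beta m).2, (beta m).2 < (beta m.+1).2,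
                (beta m).1 = q (beta m).2 &
                exists j, in_region (beta m).1 j].

Definition timed_behavior (L : 'I_nR -> set AP) (beta : nat -> conf * R)
    (sigma : timed_word R AP) :=
  forall m, exists2 j, in_region (beta m).1 j & sigma m = (L j, (beta m).2).

Definition sequence_satisfies (L : 'I_nR -> set AP) (beta : nat -> conf * R)
    (phi : mitl R AP) :=
  (exists sigma, timed_behavior L beta sigma) /\
  (forall sigma, timed_behavior L beta sigma -> models sigma phi).

(** * Execution of a run *)

Definition execution (dt : 'I_nR -> 'I_nR -> R) (U : protocol_family)
    (r : nat -> 'I_nR) (t : nat -> R) (q dq : R -> conf) (u : R -> 'cV[R]_(\sum_(i < N) 6)) :=
  forall m, closed_loop (U (r m) (r m.+1) (t m) (q (t m)) (dq (t m)))
              (t m) (dt (r m) (r m.+1)) q dq u.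

End System.

(* Main.v *)
(* Each protocol, started in a region, ends in the next region of the run, in
   an admissible state from which the next protocol can be started; so the
   closed-loop solutions can be concatenated.  Disjointness of the regions
   forces every duration used to be positive, and as there are finitely many
   pairs of regions the durations are bounded below: the switching times tend
   to infinity and the concatenation is defined for all nonnegative times.
   Disjointness also makes the region containing the system unique, so every
   timed behavior of the sampled trajectory is the word of the run. *)
Require Import Defs.
From HB Require Import structures.
From mathcomp Require Import all_boot all_order all_algebra.
From mathcomp Require Import all_classical all_reals all_analysis.
Set Implicit Arguments.
Unset Strict Implicit.
Unset Printing Implicit Defensive.
Import Order.TTheory GRing.Theory Num.Theory.
Import numFieldNormedType.Exports.
Local Open Scope classical_set_scope.
Local Open Scope ring_scope.

(** * Partitions of a half-line by switching times *)

Lemma step_partition (R : realType) (d : R) (t : nat -> R) :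
  0 < d -> t 0%N = 0 -> (forall m, t m + d <= t m.+1) ->
  forall s, 0 <= s -> exists m, t m <= s < t m.+1.
Proof.
move=> d0 t0 td s s0.
(* This linear lower bound makes [t] unbounded. The least index whose time exceeds [s] cannot be 0,
   and its predecessor is the index sought. *)
have tge m : d * m%:R <= t m.
  elim: m => [|m IH]; first by rewrite t0 mulr0.
  by rewrite -natr1 mulrDr mulr1 (le_trans _ (td m))// lerD2r.
have ex : exists m, s < t m.
  exists (Num.truncn (s / d)).+1; apply: lt_le_trans (tge _).
  by rewrite mulrC -ltr_pdivrMr// truncnS_gt.
case: (ex_minnP ex) => [[|m]]; first by rewrite t0 ltNge s0.
move=> sm min; exists m; rewrite sm andbT leNgt; apply/negP => /min.
by rewrite ltnn.
Qed.

Lemma step_index_unique (d : Order.disp_t) (T : orderType d) (t : nat -> T)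
    (s : T) (m m' : nat) :
  {homo t : i j / (i <= j)%N >-> (i <= j)%O} ->
  (t m <= s < t m.+1)%O -> (t m' <= s < t m'.+1)%O -> m = m'.
Proof.
move=> tmono /andP[ms sm] /andP[m's sm'].
case: (ltngtP m m') => // /tmono h.
- by have := lt_le_trans sm (le_trans h m's); rewrite ltxx.
- by have := lt_le_trans sm' (le_trans h ms); rewrite ltxx.
Qed.

Lemma edistxx (R : realType) (a : 'cV[R]_3) : Defs.edist a a = 0.
Proof. by rewrite /Defs.edist big1 ?sqrtr0// => k _; rewrite subrr expr0n. Qed.

(** * Geometry of the regions *)

Section Regions.
Variables (R : realType) (N : nat) (n : 'I_N -> nat) (nR : nat).
Local Notation conf := 'cV[R]_(\sum_(i < N) n i).
Variables (S : system R n) (E : workspace R n nR).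
Hypothesis hE : workspace_ok S E.

(** The body is nonempty, so one of its points would lie in two disjoint regions. *)
Lemma in_region_inj (q : conf) j j' :
  in_region S E q j -> in_region S E q j' -> j = j'.
Proof.
case: hE => _ _ hbody _ _ /trivIsetP htriv _ _ [qj _] [qj' _].
have [[p qp] _] := hbody q.
apply/eqP/negPn/negP => /(htriv j j' I I) h0.
have : (region E j `&` region E j') p by split; [exact: qj|exact: qj'].
by rewrite h0.
Qed.

(** [Lhat E] bounds a supremum of distances over a nonempty set: the body at configuration 0 already
    supplies one. *)
Lemma Lhat_ge0 : 0 <= Lhat E.
Proof.
case: hE => _ _ hbody hsup _ _ _ _.
have [[p p0] _] := hbody 0.
rewrite -lee_fin; apply: le_trans hsup.
apply: (@le_trans _ _ (Defs.edist p (pos (xO S 0)))%:E).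
  by rewrite lee_fin sqrtr_ge0.
by apply: ereal_sup_ubound; exists (0, p).
Qed.

Lemma adjacent_neq j j' : Defs.adjacent E j j' -> j <> j'.
Proof.
case: hE => l0_gt0 _ _ _ _ _ _ _ + jj'; rewrite jj' /Defs.adjacent edistxx.
move/esym/eqP; rewrite -mulrDr mulf_eq0 pnatr_eq0/= gt_eqF//.
by rewrite ltr_wpDl// Lhat_ge0.
Qed.

End Regions.

(** * Dependence of solutions on their restriction to the time interval *)

Section Trajectories.
Variables (R : realType) (N : nat) (n : 'I_N -> nat).
Local Notation conf := 'cV[R]_(\sum_(i < N) n i).
Variables (S : system R n).
Implicit Types (q dq : R -> conf) (u : R -> 'cV[R]_(\sum_(i < N) 6)).

(** Derivatives enter only at interior times, where equality on [[a, b]] is equality on a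
    neighbourhood; continuity is relative to [[a, b]]. *)
Lemma coupled_solution_eq (a b : R) q dq u q' dq' u' :
  (forall s, a <= s <= b -> q s = q' s) ->
  (forall s, a <= s <= b -> dq s = dq' s) ->
  (forall s, a <= s < b -> u s = u' s) ->
  coupled_solution S a b q dq u -> coupled_solution S a b q' dq' u'.
Proof.
move=> eq edq eu [cq cdq adm kin dyn].
have near_eq (V : normedModType R) (f g : R -> V) s : a < s < b ->
    (forall x, a <= x <= b -> f x = g x) -> {near s, f =1 g}.
  move=> sab fg; have sI : s \in `]a, b[ by rewrite in_itv.
  apply: filterS (near_in_itvoo sI) => x.
  by rewrite in_itv/= => /andP[ax xb]; apply: fg; rewrite !ltW.
split.
- apply: subspace_eq_continuous cq => s; rewrite inE/= in_itv/=; exact: eq.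
- apply: subspace_eq_continuous cdq => s; rewrite inE/= in_itv/=; exact: edq.
- by move=> s sab; rewrite -(eq s sab) -(edq s sab); exact: adm.
- move=> s sab; have [D E] := kin s sab; have nq := near_eq _ _ _ _ sab eq.
  split; first exact: near_eq_derivable nq D.
  rewrite -edq; last by case/andP: sab => *; rewrite !ltW.
  by rewrite -E !derive1E; apply/esym/near_eq_derive.
- move=> s sab; have [D E] := dyn s sab.
  have eqv x : a <= x <= b -> vO S (q x) (dq x) = vO S (q' x) (dq' x).
    by move=> xab; rewrite (eq x xab) (edq x xab).
  have nv := near_eq _ (fun x => vO S (q x) (dq x))
                       (fun x => vO S (q' x) (dq' x)) s sab eqv.
  split; first exact: near_eq_derivable nv D.
  have sab' : a <= s <= b by case/andP: sab => *; rewrite !ltW.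
  have sab'' : a <= s < b by case/andP: sab => /ltW -> ->.
  rewrite -(eq s sab') -(edq s sab') -(eu s sab'') -E !derive1E.
  by rewrite (near_eq_derive (1 : R) nv).
Qed.

(* The input may differ at the right end point, where the next protocol takes
   over. *)
Lemma closed_loop_eq P (a d : R) q dq u q' dq' u' :
  (forall s, a <= s <= a + d -> q s = q' s) ->
  (forall s, a <= s <= a + d -> dq s = dq' s) ->
  (forall s, a <= s < a + d -> u s = u' s) ->
  closed_loop S P a d q dq u -> closed_loop S P a d q' dq' u'.
Proof.
move=> eq edq eu [sol ctrl]; split; first exact: coupled_solution_eq sol.
move=> s sad; have sad' : a <= s <= a + d by case/andP: sad => -> /ltW.
by rewrite -(eu s sad) -(eq s sad') -(edq s sad') ctrl.
Qed.

End Trajectories.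


(** * Chaining and concatenation of closed-loop solutions *)

Section Execution.
Variables (R : realType) (N : nat) (n : 'I_N -> nat) (nR : nat).
Local Notation conf := 'cV[R]_(\sum_(i < N) n i).
Local Notation input := 'cV[R]_(\sum_(i < N) 6).
Variables (S : system R n) (E : workspace R n nR).
Variables (dt : 'I_nR -> 'I_nR -> R) (U : protocol_family R n nR).
Hypotheses (hE : workspace_ok S E) (hdt : forall j j', 0 <= dt j j')
  (hfact : achieves_transitions S E dt U).

(** The region comes from [hfact]. Admissibility at the final time comes from [coupled_solution],
    which demands it on the closed interval. *)
Lemma closed_loop_reach j j' t0 q dq u :
  Defs.adjacent E j j' -> 0 <= t0 ->
  admissible S (q t0) (dq t0) -> in_region S E (q t0) j ->
  closed_loop S (U j j' t0 (q t0) (dq t0)) t0 (dt j j') q dq u ->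
  admissible S (q (t0 + dt j j')) (dq (t0 + dt j j')) /\
  in_region S E (q (t0 + dt j j')) j'.
Proof.
move=> jj' t0_ge0 adm qj cl.
have [_ /(_ q dq u erefl erefl cl)[_ qj' _]] := hfact jj' t0_ge0 adm qj.
split; last exact: qj'.
case: cl => -[_ _ + _ _] _; apply.
by rewrite lerDl hdt lexx.
Qed.

(* A transition of zero duration would put the body in two disjoint regions. *)
Lemma duration_gt0 j j' q0 dq0 :
  Defs.adjacent E j j' -> admissible S q0 dq0 -> in_region S E q0 j ->
  0 < dt j j'.
Proof.
move=> jj' adm qj; rewrite lt_neqAle hdt andbT eq_sym; apply/eqP => dt0.
(* The starting time 0 is an arbitrary choice; with zero duration the final state is the initial
   one. *)
have [[q [dq [u [q00 dq00 cl]]]] _] := hfact jj' (lexx 0) adm qj.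
rewrite -q00 -dq00 in adm qj cl.
have [_] := closed_loop_reach jj' (lexx 0) adm qj cl.
rewrite dt0 addr0 => /(in_region_inj hE qj).
exact: (adjacent_neq hE jj').
Qed.

Variables (r : nat -> 'I_nR) (t : nat -> R).
Hypotheses (hadj : forall m, Defs.adjacent E (r m) (r m.+1))
  (ht0 : t 0%N = 0) (htS : forall m, t m.+1 = t m + dt (r m) (r m.+1)).

Lemma switching_times_homo : {homo t : i j / (i <= j)%N >-> i <= j}.
Proof.
apply: homo_leq => [x|x y z|m]; [exact: lexx|exact: le_trans|].
by rewrite htS lerDl.
Qed.

Lemma switching_times_ge0 m : 0 <= t m.
Proof. by rewrite -ht0 switching_times_homo. Qed.

(** The invariant at the switching times: the conditions on the state under which [hfact] applies to
    the next protocol. *)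
Let starts m (z : conf * conf) :=
  admissible S z.1 z.2 /\ in_region S E z.1 (r m).

(** Induction along the run, for an arbitrary execution and not just the one constructed below. *)
Lemma execution_starts q dq u :
  starts 0 (q 0, dq 0) -> execution S dt U r t q dq u ->
  forall m, starts m (q (t m), dq (t m)).
Proof.
move=> h0 ex; elim=> [|m [adm qm]]; first by rewrite ht0.
rewrite htS; apply: closed_loop_reach (ex m) => //.
exact: switching_times_ge0.
Qed.

Let piece m (z : conf * conf) (w : (R -> conf) * (R -> conf) * (R -> input)) :=
  [/\ w.1.1 (t m) = z.1, w.1.2 (t m) = z.2 &
      closed_loop S (U (r m) (r m.+1) (t m) z.1 z.2) (t m) (dt (r m) (r m.+1))
        w.1.1 w.1.2 w.2].

Lemma piece_reach m z w : starts m z -> piece m z w ->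
  starts m.+1 (w.1.1 (t m.+1), w.1.2 (t m.+1)).
Proof.
case: z w => a b [[q dq] u] [/= adm am] [/= qa dqb].
rewrite -qa -dqb in adm am *; rewrite htS => cl.
exact: closed_loop_reach (hadj m) (switching_times_ge0 m) adm am cl.
Qed.

Lemma execution_pieces (z0 : conf * conf) : starts 0 z0 ->
  exists z w, [/\ z 0%N = z0,
    forall m, starts m (z m) /\ piece m (z m) (w m) &
    forall m, z m.+1 = ((w m).1.1 (t m.+1), (w m).1.2 (t m.+1))].
Proof.
move=> hz0.
(* Pieces are chosen for all index-state pairs at once, with a zero default when [starts] fails, so
   that [z] can be defined by recursion before its invariant is proved. *)
have /choice[F HF] : forall y : nat * (conf * conf), exists w,
    starts y.1 y.2 -> piece y.1 y.2 w.
  move=> [m z]; have [hz|hz] := pselect (starts m z); last first.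
    by exists (fun=> 0, fun=> 0, fun=> 0) => /hz.
  have [adm zm] := hz.
  have [[q [dq [u [qz dqz cl]]]] _] :=
    hfact (hadj m) (switching_times_ge0 m) adm zm.
  by exists (q, dq, u).
pose z := fix z m := if m is m'.+1 then
  let w := F (m', z m') in (w.1.1 (t m), w.1.2 (t m)) else z0.
have hz m : starts m (z m).
  by elim: m => [//|m hzm]; exact: piece_reach hzm (HF (m, z m) hzm).
exists z, (fun m => F (m, z m)).
by split=> [|m|m]; [|split; [exact: hz|exact/HF/hz]|].
Qed.

(** [duration_gt0] needs an admissible state in the source region; the chain of pieces provides one
    for each step of the run. *)
Lemma switching_times_increment (z0 : conf * conf) : starts 0 z0 ->
  exists2 d, 0 < d & forall m, t m + d <= t m.+1.
Proof.
move=> /execution_pieces[z [w [_ hz _]]].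
(* Only positive durations enter this finite minimum, and 1 is its value if there are none, so it is
   positive. *)
exists (\big[Order.min/1]_(p : 'I_nR * 'I_nR | 0 < dt p.1 p.2) dt p.1 p.2).
  exact: lt_bigmin.
move=> m; rewrite htS lerD2l.
apply: (bigmin_le_cond _ (j := (r m, r m.+1))) => /=.
by have [[adm zm] _] := hz m; exact: duration_gt0 adm zm.
Qed.

Lemma execution_exists (q0 dq0 : conf) : starts 0 (q0, dq0) ->
  exists q dq u, [/\ q 0 = q0, dq 0 = dq0 & execution S dt U r t q dq u].
Proof.
move=> h0; have [d d0 td] := switching_times_increment h0.
have [z [w [z0 hz zS]]] := execution_pieces h0.
have /choice[idx Hidx] : forall s, exists m, 0 <= s -> t m <= s < t m.+1.
  move=> s; have [s0|_] := leP 0 s; last by exists 0%N.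
  by have [m hm] := step_partition d0 ht0 td s0; exists m.
have idxE m s : t m <= s < t m.+1 -> idx s = m.
  move=> sm; apply: (step_index_unique switching_times_homo _ sm).
  apply: Hidx; apply: le_trans (switching_times_ge0 m) _.
  by case/andP: sm.
have idxt m : idx (t m) = m.
  by apply: idxE; rewrite lexx (lt_le_trans _ (td m))// ltrDl.
(* Since [idx] uses half-open intervals, the value at [t m.+1] is taken from piece [m.+1]; it agrees
   with the end of piece [m] by [zS]. *)
pose q s := (w (idx s)).1.1 s; pose dq s := (w (idx s)).1.2 s.
pose u s := (w (idx s)).2 s.
have qt m : q (t m) = (z m).1 by rewrite /q idxt; have [_ []] := hz m.
have dqt m : dq (t m) = (z m).2 by rewrite /dq idxt; have [_ []] := hz m.
(* State and velocity must match each piece on the closed interval, hence the separate end-point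
   condition; the input need match only on the half-open one. *)
have closed (f : R -> conf) (g : R -> conf) m :
    (forall s, t m <= s < t m.+1 -> f s = g s) -> f (t m.+1) = g (t m.+1) ->
    forall s, t m <= s <= t m + dt (r m) (r m.+1) -> f s = g s.
  move=> fg fgt s; rewrite -htS le_eqVlt (le_eqVlt s).
  move=> /andP[ms /orP[/eqP->//|sm]]; apply: fg.
  by rewrite sm andbT le_eqVlt.
exists q, dq, u; split.
- by rewrite -ht0 qt z0.
- by rewrite -ht0 dqt z0.
move=> m; rewrite qt dqt; have [_ [_ _ cl]] := hz m.
apply: closed_loop_eq cl.
- apply: closed => [s /idxE sm|]; first by rewrite /q sm.
  by rewrite qt zS.
- apply: closed => [s /idxE sm|]; first by rewrite /dq sm.
  by rewrite dqt zS.
- by move=> s; rewrite -htS => /idxE sm; rewrite /u sm.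
Qed.

End Execution.

(** * Executions of the run and their timed behaviors *)

Theorem theorem3 (R : realType) (N : nat) (n : 'I_N -> nat) (nR : nat)
    (AP : Type)
    (hn : forall i, (6 <= n i)%N)
    (S : system R n) (hkin : kinematics_ok S) (hdyn : dynamics_ok S)
    (E : workspace R n nR) (hE : workspace_ok S E)
    (dt : 'I_nR -> 'I_nR -> R) (hdt : forall j j', 0 <= dt j j')
    (U : protocol_family R n nR)
    (hU : family_ok S E dt U)
    (hfact : achieves_transitions S E dt U)
    (Pi0 : set 'I_nR) (L : 'I_nR -> set AP) (phi : mitl R AP)
    (q0 dq0 : 'cV[R]_(\sum_(i < N) n i)) (h0 : admissible S q0 dq0)
    (r : nat -> 'I_nR) (t : nat -> R)
    (hrun : timed_run S E (abstraction S E Pi0 L dt) q0 r t)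
    (hsat : models (run_word (abstraction S E Pi0 L dt) r t) phi) :
  [/\ (forall s, 0 <= s -> exists m, t m <= s < t m.+1),
      (exists q dq u,
         [/\ q 0 = q0, dq 0 = dq0 & execution S dt U r t q dq u]) &
      (forall q dq u,
         q 0 = q0 -> dq 0 = dq0 -> execution S dt U r t q dq u ->
         exists beta : nat -> 'cV[R]_(\sum_(i < N) n i) * R,
           [/\ timed_sequence S E q beta,
               (forall m, (beta m).2 = t m /\ in_region S E (beta m).1 (r m)),
               timed_behavior S E L beta (fun m => (L (r m), t m)) &
               sequence_satisfies S E L beta phi])].

Proof.
have [_ q0r tr t0 tS] := hrun.
have adj m : Defs.adjacent E (r m) (r m.+1) by case: (tr m).
have [d d0 td] :=
  switching_times_increment hE hdt hfact adj t0 tS (conj h0 q0r : _ (q0, dq0)).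
split=> [s|| q dq u q00 dq00 ex].
- exact: step_partition d0 t0 td s.
- exact: (execution_exists hE hdt hfact adj t0 tS).
have start0 : admissible S (q 0) (dq 0) /\ in_region S E (q 0) (r 0%N).
  by rewrite q00 dq00.
have qr m : in_region S E (q (t m)) (r m).
  by have [] := execution_starts hdt hfact adj t0 tS start0 ex m.
have beh :
    timed_behavior S E L (fun m => (q (t m), t m)) (fun m => (L (r m), t m)).
  by move=> m; exists (r m); first exact: qr.
exists (fun m => (q (t m), t m)).
split; [|by move=> m; split; [|exact: qr]|exact: beh|].
- move=> m; split; last by exists (r m); exact: qr.
  + exact: (switching_times_ge0 hdt t0 tS m).
  + by rewrite (lt_le_trans _ (td m))// ltrDl.
  + by [].
- split=> [|sigma hsigma]; first by exists (fun m => (L (r m), t m)).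
  (* The labels of [sigma] come from regions chosen freely at each time, and [in_region_inj]
     identifies these with the regions of the run. *)
  suff -> : sigma = run_word (abstraction S E Pi0 L dt) r t by [].
  apply/funext => m; have [j qj ->] := hsigma m.
  by rewrite (in_region_inj hE qj (qr m)).
Qed.
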